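(* Let $X_1,\ldots,X_n$ be random variables such that $0\le X_i\le 1$ for $i=1,\ldots,n$. For every subset $A\subseteq [n]$ define the random variable $$Z_A=\prod_{i\in A}X_i\prod_{i\in [n]\setminus A}(1-X_i).$$ Let $\mathcal{F}$ be the set of all functions $f:\mathbb{R}\to[0,+\infty)$ that are increasing and convex, and set $p:=\frac1n\sum_{i=1}^n\mathbb{E}[X_i]$. If $t$ is a real number such that $np<t<n$, then $\sum_{A\subseteq[n]}\mathbb{E}[Z_A]=1$ and $$\mathbb{P}\left[\sum_{i=1}^nX_i\ge t\right]\le \inf_{f\in\mathcal{F}}\frac{1}{f(t)}\,\mathbb{E}[f(Z)],$$ where $Z$ is a random variable taking values in $\{0,1,\ldots,n\}$ with $$\mathbb{P}[Z=j]=\sum_{A\in\partial_j[n]}\mathbb{E}[Z_A],\qquad j=0,1,\ldots,n.$$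
   Context: The random variables $X_1,\ldots,X_n$ are defined on a common probability space and may be dependent. $[n]=\{1,\ldots,n\}$; $\partial_j[n]$ denotes the family of all subsets of $[n]$ of cardinality $j$. Empty products equal $1$. ''Increasing'' means non-decreasing. In the infimum, only functions $f\in\mathcal{F}$ with $f(t)>0$ are considered. *)

(* Defs.v *)
From HB Require Import structures.
From mathcomp Require Import all_boot all_order all_algebra.
From mathcomp Require Import all_classical all_reals all_analysis.

Set Implicit Arguments.
Unset Strict Implicit.
Unset Printing Implicit Defensive.

Import Order.TTheory GRing.Theory Num.Theory.
Local Open Scope classical_set_scope.
Local Open Scope ring_scope.

Definition prodZ (R : realType) (T : Type) (n : nat) (X : 'I_n -> T -> R)
    (A : {set 'I_n}) (w : T) : R :=
  \prod_(i | i \in A) X i w * \prod_(i | i \notin A) (1 - X i w).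

(* Extended-real valued because ['E_P[_]] is. *)
Definition avg_mean (R : realType) d (T : measurableType d)
    (P : probability T R) (n : nat) (X : 'I_n -> {RV P >-> R}) : \bar R :=
  ((n%:R^-1)%:E * \sum_(i < n) 'E_P[X i])%E.

Definition incr_convex (R : realType) : set (R -> R) :=
  [set f | [/\ (forall x, 0 <= f x),
               {homo f : x y / x <= y} &
               convex_function [set: R] f] ].

Definition level_mass (R : realType) d (T : measurableType d)
    (P : probability T R) (n : nat) (X : 'I_n -> {RV P >-> R}) (j : nat) :
    \bar R :=
  (\sum_(A : {set 'I_n} | #|A| == j) 'E_P[prodZ X A])%E.

(* Main.v *)
Require Import Defs.
From HB Require Import structures.
From mathcomp Require Import all_boot all_order all_algebra.
From mathcomp Require Import all_classical all_reals all_analysis.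
From mathcomp Require Import measurable_realfun.
From mathcomp Require Import ring lra.

Set Implicit Arguments.
Unset Strict Implicit.
Unset Printing Implicit Defensive.

Import Order.TTheory GRing.Theory Num.Theory.
Local Open Scope classical_set_scope.
Local Open Scope ring_scope.

(** Fix [w] and toss independent coins with success probabilities [X i w].
    Then [prodZ X A w] is the probability that [A] is the set of successes, so
    these numbers are nonnegative weights of sum 1 ([prodZ_ge0], [sum_prodZ]),
    and the mean of [#|A|] under them is the expected number of successes,
    [\sum_i X i w] ([sum_prodZ_card]).  No independence of the random variables
    [X i] is involved: the coins are tossed for one [w] at a time.

    Jensen's inequality for these weights ([convex_sum_le_prodZ]) bounds
    [f (\sum_i X i w)] by [\sum_A f #|A| * prodZ X A w].  As [f] is nonnegative
    and increasing, [f t] times the probability of the event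
    [t <= \sum_i X i] is at most the expectation of that bound
    ([prob_ge_le_expectation]).  By linearity the latter is
    [\sum_A f #|A| * E (prodZ X A)], and grouping the sets [A] by cardinality
    ([sum_level_mass]) gives [\sum_j f j * P (Z = j)], which is [E (f Z)]
    ([expectation_comp_nat_valued]).  It remains to divide by [f t] and to take
    the infimum over [f].  The equality [\sum_A E (prodZ X A) = 1] is the
    expectation of the pointwise one. *)

Lemma convex_function2 (R : realType) (f : R -> R) (l x y : R) :
  convex_function [set: R] f -> 0 <= l <= 1 ->
  f (l * x + (1 - l) * y) <= l * f x + (1 - l) * f y.
Proof.
move=> cf /andP[l0 l1].
by have := cf (Itv01 l0 l1) x y (mem_setT _) (mem_setT _).
Qed.

(** Jensen's inequality for subprobability weights, the missing mass being put
    on a free point [c].  This form can be proved by induction on the list: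
    an additional entry is merged with [c] into one new free point, so that the
    weights are never renormalized. *)
Lemma convex_sum_le (R : realType) (f : R -> R) (I : Type) (r : seq I)
    (p x : I -> R) (c : R) :
  convex_function [set: R] f -> (forall i, 0 <= p i) ->
  \sum_(i <- r) p i <= 1 ->
  f (\sum_(i <- r) p i * x i + (1 - \sum_(i <- r) p i) * c) <=
  \sum_(i <- r) p i * f (x i) + (1 - \sum_(i <- r) p i) * f c.
Proof.
move=> cf p0; elim: r c => [|a r IH] c.
  by rewrite !big_nil subr0 !mul1r !add0r.
rewrite !big_cons; set m := \sum_(i <- r) p i.
have pa0 := p0 a => pm1.
(* If the tail already has mass 1, there is no free mass to merge into, but
   then the head has weight 0. *)
have [m1|m1] := eqVneq (1 - m) 0.
  have pa : p a = 0 by lra.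
  by rewrite pa !mul0r !add0r; apply: IH; rewrite -/m; lra.
have m_lt1 : 0 < 1 - m by rewrite lt_neqAle eq_sym m1; lra.
have [l l01 le_l] : exists2 l, 0 <= l <= 1 & (1 - m) * l = p a.
  exists (p a / (1 - m)); last by field.
  by rewrite divr_ge0 ?(ltW m_lt1)//= ler_pdivrMr// mul1r; lra.
have le_l' : (1 - m) * (1 - l) = 1 - (p a + m) by rewrite mulrBr le_l; ring.
have m_le1 : m <= 1 by lra.
have {IH} := IH (l * x a + (1 - l) * c) m_le1.
rewrite -/m mulrDr !mulrA le_l le_l' => IH.
rewrite -addrA addrCA; apply: (le_trans IH).
rewrite -[leRHS]addrA [leRHS]addrCA lerD2l.
rewrite -le_l' -le_l -!mulrA -mulrDr ler_pM2l//.
exact: convex_function2.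
Qed.

Lemma jensen_finite (R : realType) (f : R -> R) (I : finType) (p x : I -> R) :
  convex_function [set: R] f -> (forall i, 0 <= p i) -> \sum_i p i = 1 ->
  f (\sum_i p i * x i) <= \sum_i p i * f (x i).
Proof.
move=> cf p0 p1.
have := @convex_sum_le R f I (index_enum I) p x 0 cf p0.
by rewrite p1 lexx subrr !mul0r !addr0; apply.
Qed.

Section BernoulliSubset.
Context {R : realType} {T : Type} {n : nat} (X : 'I_n -> T -> R) (w : T).

(** A single product over all indices, the form that distributivity of
    products over sums produces. *)
Lemma prodZE A :
  prodZ X A w = \prod_i (if i \in A then X i w else 1 - X i w).
Proof.
rewrite (bigID (mem A))/= /prodZ; congr (_ * _).
  by apply: eq_bigr => i ->.
by apply: eq_bigr => i /negbTE ->.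
Qed.

Lemma sum_prodZ : \sum_(A : {set 'I_n}) prodZ X A w = 1.
Proof.
transitivity (\prod_(i < n) (X i w + (1 - X i w))).
  by rewrite bigA_distr; apply: eq_bigr => A _; rewrite prodZE.
by rewrite big1// => i _; ring.
Qed.

(** The probability that the coin [i] succeeds.  Requiring [i \in A] amounts
    to replacing the failure factor [1 - X i w] by [0]; the expanded sum is then
    again a product, whose factors other than the one at [i] are [1]. *)
Lemma sum_prodZ_mem i :
  \sum_(A : {set 'I_n}) prodZ X A w * (i \in A)%:R = X i w.
Proof.
transitivity (\prod_j (X j w + (if j == i then 0 else 1 - X j w))).
  rewrite bigA_distr; apply: eq_bigr => A _; rewrite prodZE.
  rewrite (bigD1 i)//= [RHS](bigD1 i)//= eqxx.
  case: ifP => iA; last by rewrite mulr0 mul0r.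
  rewrite mulr1; congr (_ * _).
  by apply: eq_bigr => j /negbTE ->.
rewrite (bigD1 i)//= eqxx addr0 big1 ?mulr1// => j /negbTE ->; ring.
Qed.

(** Linearity of the mean, [#|A|] being the sum of the indicators of
    [i \in A]. *)
Lemma sum_prodZ_card :
  \sum_(A : {set 'I_n}) prodZ X A w * #|A|%:R = \sum_i X i w.
Proof.
under eq_bigr do rewrite -sum1_card natr_sum big_mkcond mulr_sumr.
rewrite exchange_big; apply: eq_bigr => i _/=.
rewrite -[RHS]sum_prodZ_mem; apply: eq_bigr => A _.
by case: (i \in A).
Qed.

Hypothesis X01 : forall i, 0 <= X i w <= 1.

Lemma prodZ_ge0 A : 0 <= prodZ X A w.
Proof.
rewrite prodZE prodr_ge0// => i _.
by have := X01 i; case: ifP => _ /andP[]// _; rewrite subr_ge0.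
Qed.

Lemma convex_sum_le_prodZ (f : R -> R) : convex_function [set: R] f ->
  f (\sum_i X i w) <= \sum_(A : {set 'I_n}) f #|A|%:R * prodZ X A w.
Proof.
move=> cf; rewrite -sum_prodZ_card.
under [leRHS]eq_bigr do rewrite mulrC.
exact: jensen_finite cf prodZ_ge0 sum_prodZ.
Qed.

End BernoulliSubset.

Lemma measurable_prodZ (R : realType) d (T : measurableType d) (n : nat)
    (X : 'I_n -> T -> R) (A : {set 'I_n}) :
  (forall i, measurable_fun setT (X i)) -> measurable_fun setT (prodZ X A).
Proof.
move=> mX; rewrite (_ : prodZ X A =
    fun w => \prod_i (if i \in A then X i w else 1 - X i w)); last first.
  by apply/funext => w; exact: prodZE.
apply: measurable_prod => i _; case: (i \in A); first exact: mX.
by apply: measurable_funB => //; exact: mX.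
Qed.

Section ExpectationBounds.
Local Open Scope ereal_scope.
Context {R : realType} {d : measure_display} {T : measurableType d}.
Variable P : probability T R.

Lemma ge0_expectation_sum (I : finType) (c : I -> R) (g : I -> T -> R) :
  (forall i, (0 <= c i)%R) -> (forall i w, (0 <= g i w)%R) ->
  (forall i, measurable_fun setT (g i)) ->
  'E_P[fun w => \sum_i c i * g i w]%R = \sum_i (c i)%:E * 'E_P[g i].
Proof.
move=> c0 g0 mg; rewrite unlock.
under eq_integral do rewrite -sumEFin/=.
rewrite ge0_integral_sum//; last 2 first.
- by move=> i; apply/measurable_EFinP; apply: measurable_funM.
- by move=> i w _; rewrite lee_fin mulr_ge0.
apply: eq_bigr => i _.
under eq_integral do rewrite EFinM.
rewrite ge0_integralZl_EFin//; last exact/measurable_EFinP.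
by move=> w _; rewrite lee_fin.
Qed.

(** Since [Z] takes finitely many values, [f \o Z] is a combination of
    indicators of the events [Z = j]. *)
Lemma expectation_comp_nat_valued (f : R -> R) (Z : {RV P >-> R}) (n : nat) :
  (forall x, (0 <= f x)%R) ->
  (forall w, exists2 j : nat, (j <= n)%N & Z w = j%:R) ->
  'E_P[f \o Z] = \sum_(j < n.+1) (f j%:R)%:E * P [set w | Z w = j%:R].
Proof.
move=> f0 Zn.
have mZ j : measurable [set w | Z w = j%:R :> R].
  exact: (measurable_funPTI Z (measurable_set1 (j%:R : R))).
have -> : f \o Z =
    (fun w => \sum_(j < n.+1) f j%:R * \1_[set w | Z w = (j : nat)%:R] w)%R.
  apply/funext => w /=; have [j jn Zj] := Zn w.
  rewrite (bigD1 (Ordinal (jn : (j < n.+1)%N)))//= big1 => [|k kj].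
    by rewrite indicE mem_set// mulr1 addr0 Zj.
  rewrite indicE memNset ?mulr0//= Zj => /eqP; rewrite eqr_nat => /eqP jk.
  by move/eqP: kj; apply; apply/val_inj.
rewrite ge0_expectation_sum//; last first.
  by move=> j; exact: measurable_indic.
by apply: eq_bigr => j _; rewrite expectation_indic.
Qed.

(** Markov's inequality with a measurable majorant [G] of [f \o Y] in place of
    [f \o Y]. On the event [t <= Y] monotonicity gives [f t <= f (Y w) <= G w],
    and elsewhere [0 <= f (Y w) <= G w]. *)
Lemma prob_ge_le_expectation (f : R -> R) (Y G : T -> R) (t : R) :
  {homo f : x y / (x <= y)%R} -> (forall x, (0 <= f x)%R) ->
  measurable_fun setT Y -> measurable_fun setT G ->
  (forall w, f (Y w) <= G w)%R ->
  (f t)%:E * P [set w | (t <= Y w)%R] <= 'E_P[G].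
Proof.
move=> fmono f0 mY mG fYG.
have mA : measurable [set w | (t <= Y w)%R].
  rewrite -[X in measurable X]setTI.
  have := mY measurableT _ (measurable_itv `[t, +oo[).
  by rewrite set_itvE.
rewrite -(expectation_indic P mA) unlock -ge0_integralZl_EFin//; last first.
  exact/measurable_EFinP/measurable_indic.
apply: ge0_le_integral => //.
- by move=> w _; rewrite -EFinM lee_fin mulr_ge0.
- by apply/measurable_EFinP; apply: measurable_funM.
- exact/measurable_EFinP.
- move=> w _; rewrite -EFinM lee_fin indicE.
  have [tY|_] := boolP (w \in _); last by rewrite mulr0 (le_trans (f0 (Y w))).
  rewrite mulr1 (le_trans _ (fYG w))// fmono//.
  by rewrite inE in tY.
Qed.

End ExpectationBounds.

Lemma sum_level_mass (R : realType) d (T : measurableType d)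
    (P : probability T R) (n : nat) (X : 'I_n -> {RV P >-> R}) (c : nat -> R) :
  (forall i w, 0 <= X i w <= 1) ->
  (\sum_(j < n.+1) (c j)%:E * level_mass X j =
   \sum_(A : {set 'I_n}) (c #|A|)%:E * 'E_P[prodZ X A])%E.
Proof.
move=> X01.
have cardA (A : {set 'I_n}) : (#|A| < n.+1)%N.
  by rewrite ltnS -[leqRHS]card_ord max_card.
rewrite (partition_big (fun A : {set 'I_n} => Ordinal (cardA A)) predT)//=.
apply: eq_bigr => j _; rewrite /level_mass ge0_sume_distrr => [|A _]; last first.
  by apply: expectation_ge0 => w; apply: prodZ_ge0.
by apply: eq_big => [A|A /eqP ->].
Qed.
Theorem theorem1p4 (R : realType) (d : measure_display) (T : measurableType d)
    (P : probability T R) (n : nat) (X : 'I_n -> {RV P >-> R})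
    (hX : forall (i : 'I_n) (w : T), 0 <= X i w <= 1)
    (t : R) (ht1 : (n%:R%:E * avg_mean X < t%:E)%E) (ht2 : t < n%:R) :
  (\sum_(A : {set 'I_n}) 'E_P[prodZ X A])%E = 1%E /\
  (forall (d' : measure_display) (T' : measurableType d')
      (Q : probability T' R) (Z : {RV Q >-> R}),
    (forall w : T', exists2 j : nat, (j <= n)%N & Z w = j%:R) ->
    (forall j : nat, (j <= n)%N ->
       Q [set w : T' | Z w = j%:R] = level_mass X j) ->
    (P [set w : T | (t <= \sum_(i < n) X i w)%R] <=
     ereal_inf [set ((f t)^-1)%:E * 'E_Q[f \o Z] |
                f in [set f | @incr_convex R f /\ (0 < f t)%R]])%E).
Proof.
(* Used with [c] constant equal to 1 for the total mass and with [f] for the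
   tail bound. *)
have EZ (c : nat -> R) : (forall j, 0 <= c j) ->
    'E_P[fun w => (\sum_(A : {set 'I_n}) c #|A| * prodZ X A w)%R]%E =
    (\sum_(A : {set 'I_n}) (c #|A|)%:E * 'E_P[prodZ X A])%E.
  move=> c0; apply: ge0_expectation_sum => // [A w|A].
    by apply: prodZ_ge0 => i; exact: hX.
  exact: measurable_prodZ.
split.
  have /= := EZ (fun=> 1) (fun=> ler01).
  under [in X in _ = X]eq_bigr do rewrite mul1e.
  move=> <-; under [X in 'E_P[X]%E]eq_fun do
    (under eq_bigr do rewrite mul1r; rewrite sum_prodZ).
  by rewrite expectation_cst.
move=> d' T' Q Z Zn Zmass.
apply/ereal_infP => _ [f [[f0 fmono fconv] ft] <-].
rewrite lee_pdivlMl// (expectation_comp_nat_valued f0 Zn).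
under eq_bigr => j _ do rewrite Zmass ?(leq_ord j)//.
rewrite (sum_level_mass (fun j => f j%:R) hX) -(EZ (fun j => f j%:R))//.
apply: prob_ge_le_expectation => //.
- exact: measurable_sum.
- apply: measurable_sum => A; apply: measurable_funM => //.
  exact: measurable_prodZ.
- by move=> w; apply: convex_sum_le_prodZ.
Qed.
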